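(* Let $\mathbf x=(x_1,x_2,x_3,x_4,x_5,x_6,x_7)\in\mathbb C^7$. Then $\mathbf x\in K$ if and only if $(x_1,\,x_3+\eta x_5,\,\eta x_7,\,x_2+\eta x_4,\,\eta x_6)\in K_1$ for all $\eta\in\mathbb T$.
   Context: $\mathbb T$ is the unit circle. For a linear subspace $E$ of $\mathcal M_{n\times n}(\mathbb C)$, $\mu_E(A)=1/\inf\{\|X\|: X\in E,\ \det(I-AX)=0\}$, with $\mu_E(A)=0$ if $I-AX$ is nonsingular for all $X\in E$ (operator norm). $E(3;3;1,1,1)$ is the space of $3\times 3$ diagonal matrices and $E(3;2;1,2)=\{\operatorname{diag}(z_1,z_2,z_2): z_1,z_2\in\mathbb C\}$. For $A=((a_{ij}))\in\mathcal M_{3\times3}(\mathbb C)$ put $$\pi(A)=\big(a_{11},\ a_{22},\ a_{11}a_{22}-a_{12}a_{21},\ a_{33},\ a_{11}a_{33}-a_{13}a_{31},\ a_{22}a_{33}-a_{23}a_{32},\ \det A\big),$$ $$\tilde\pi(A)=\big(a_{11},\ (a_{11}a_{22}-a_{12}a_{21})+(a_{11}a_{33}-a_{13}a_{31}),\ \det A,\ a_{22}+a_{33},\ a_{22}a_{33}-a_{23}a_{32}\big).$$ Let $\Gamma_{E(3;3;1,1,1)}=\{\pi(A): \mu_{E(3;3;1,1,1)}(A)\le1\}$ and $\Gamma_{E(3;2;1,2)}=\{\tilde\pi(A): \mu_{E(3;2;1,2)}(A)\le1\}$, with $A$ ranging over $\mathcal M_{3\times 3}(\mathbb C)$. Then $$K=\{(x_1,\ldots,x_7)\in\Gamma_{E(3;3;1,1,1)}:\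 x_1=\bar x_6x_7,\ x_3=\bar x_4x_7,\ x_5=\bar x_2x_7,\ |x_7|=1\},$$ $$K_1=\{(x_1,x_2,x_3,y_1,y_2)\in\Gamma_{E(3;2;1,2)}:\ x_1=\bar y_2x_3,\ x_2=\bar y_1x_3,\ |x_3|=1\}.$$ *)

(* Defs.v *)
From mathcomp Require Import all_boot all_order all_algebra.
From mathcomp Require Import boolp classical_sets reals.
From mathcomp Require Import complex.

Set Implicit Arguments.
Unset Strict Implicit.
Unset Printing Implicit Defensive.

Import Order.TTheory GRing.Theory Num.Theory.
Local Open Scope classical_set_scope.
Local Open Scope ring_scope.
Local Open Scope complex_scope.

Section Mu.
Variables (R : realType) (n : nat).
Local Notation C := R[i].

Definition l2norm (v : 'cV[C]_n) : R :=
  Num.sqrt (\sum_(i < n) ComplexField.Normc.normc (v i ord0) ^+ 2).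

Definition opnorm (X : 'M[C]_n) : R :=
  sup [set l2norm (X *m v) | v in [set v | l2norm v <= 1]].

(* [E] is meant to be a linear subspace. A singular [1 - A X] forces
   [1 <= opnorm A * opnorm X], so the infimum of a nonempty set of such norms
   is positive and inverting it in [R] loses no infinite value. *)
Definition mu (E : set 'M[C]_n) (A : 'M[C]_n) : R :=
  if `[< forall X, E X -> 1%:M - A *m X \in unitmx >] then 0
  else 1 / inf [set opnorm X | X in
                 [set X | E X /\ \det (1%:M - A *m X) = 0]].

End Mu.

Section Domains.
Variable R : realType.
Local Notation C := R[i].

(* The numerals below are the elements 0, 1, 2 of ['I_3]: [A 0 1] is a_12. *)
Definition minor2 (A : 'M[C]_3) (i j : 'I_3) : C :=
  A i i * A j j - A i j * A j i.

Definition E111 : set 'M[C]_3 := [set X | is_diag_mx X].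

Definition diag3 (z1 z2 z3 : C) : 'M[C]_3 :=
  diag_mx (\row_(i < 3) [:: z1; z2; z3]`_i).

Definition E12 : set 'M[C]_3 := [set X | exists z1 z2, X = diag3 z1 z2 z2].

Definition C5 : Type := C * C * C * C * C.
Definition C7 : Type := C * C * C * C * C * C * C.

Definition pi7 (A : 'M[C]_3) : C7 :=
  (A 0 0, A 1 1, minor2 A 0 1, A 2 2, minor2 A 0 2, minor2 A 1 2, \det A).

Definition pi5 (A : 'M[C]_3) : C5 :=
  (A 0 0, minor2 A 0 1 + minor2 A 0 2, \det A, A 1 1 + A 2 2, minor2 A 1 2).

Definition Gamma111 : set C7 := [set pi7 A | A in [set A | mu E111 A <= 1]].

Definition Gamma12 : set C5 := [set pi5 A | A in [set A | mu E12 A <= 1]].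

Definition K : set C7 := [set x | Gamma111 x /\
  let: (x1, x2, x3, x4, x5, x6, x7) := x in
  [/\ x1 = x6^* * x7, x3 = x4^* * x7, x5 = x2^* * x7 & `|x7| = 1 :> C]].

Definition K1 : set C5 := [set x | Gamma12 x /\
  let: (x1, x2, x3, y1, y2) := x in
  [/\ x1 = y2^* * x3, x2 = y1^* * x3 & `|x3| = 1 :> C]].

End Domains.

(* Main.v *)
(** Both domains are described by zero-freeness: [pi7] is onto [C7], and for
    diagonal [X] the operator norm is the maximum modulus of the entries, so [x]
    lies in [Gamma111] iff the multi-affine polynomial [det (1 - A X)], whose
    coefficients are those of [x], has no zero in the open tridisc; likewise for
    [Gamma12] after identifying the last two variables. The hypothesis on all
    [eta] of modulus 1 thus says that the polynomial of [x] is zero-free where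
    [|z2| = |z3|]. For fixed [z1] the polynomial is bilinear in [(z2, z3)], and
    an intermediate value argument shows that a zero anywhere in the bidisc
    forces one with [|z2| = |z3|]. The algebraic conditions on [K] and [K1]
    are compared at [eta = 1] and [eta = -1]. *)

Require Import Defs.
From mathcomp Require Import all_boot all_order all_algebra.
From mathcomp Require Import boolp classical_sets reals.
From mathcomp Require Import complex ring.

Import Order.TTheory GRing.Theory Num.Theory.
Import ComplexField.Normc.
Local Open Scope classical_set_scope.
Local Open Scope ring_scope.
Local Open Scope complex_scope.

(** * Operator norms of diagonal matrices and the condition [mu <= 1] *)

Section Norms.
Variable R : realType.
Local Notation C := R[i].
Local Notation normc := (@normc R).

Lemma norm_eq1 (z : C) : `|z| = 1 <-> normc z = 1.
Proof. by split=> [[]|/(congr1 (@real_complex _))]. Qed.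

Lemma normc_ge0 (z : C) : 0 <= normc z.
Proof. by rewrite -lecR (normr_ge0 z). Qed.

Lemma l2norm_scale_delta n (i : 'I_n) (c : C) :
  l2norm (c *: delta_mx i ord0) = normc c.
Proof.
rewrite /l2norm (bigD1 i) //= !mxE !eqxx mulr1 big1 ?addr0.
  by rewrite sqrtr_sqr ger0_norm ?normc_ge0.
by move=> j /negPf ji; rewrite !mxE ji mulr0 normc0 expr0n.
Qed.

Lemma l2norm_diag_le n (d : 'rV[C]_n) (r : R) (v : 'cV[C]_n) :
  0 <= r -> (forall i, normc (d 0 i) <= r) ->
  l2norm (diag_mx d *m v) <= r * l2norm v.
Proof.
move=> r0 dr; rewrite -[X in X * _](ger0_norm r0) -sqrtr_sqr -sqrtrM ?sqr_ge0//.
rewrite ler_wsqrtr// mulr_sumr ler_sum// => i _.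
rewrite mul_diag_mx mxE normcM exprMn ler_wpM2r ?sqr_ge0//.
by rewrite lerXn2r ?nnegrE ?normc_ge0.
Qed.

Lemma l2norm0 n : l2norm (0 : 'cV[C]_n) = 0.
Proof. by rewrite /l2norm big1 ?sqrtr0// => i _; rewrite mxE normc0 expr0n. Qed.

Lemma opnorm_diag_le n (d : 'rV[C]_n) (r : R) :
  0 <= r -> (forall i, normc (d 0 i) <= r) -> opnorm (diag_mx d) <= r.
Proof.
move=> r0 dr; apply: ge_sup => [|_ [v /= v1 <-]].
  by exists (l2norm (diag_mx d *m 0)), 0; rewrite //= l2norm0 ler01.
by apply: (le_trans (l2norm_diag_le _ _ _ _ r0 dr)); rewrite ler_piMr.
Qed.

(** The [i]-th basis vector attains the value; the maximum of the entries bounds the set, so that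
    its [sup] is meaningful. *)
Lemma normc_le_opnorm n (d : 'rV[C]_n) i : normc (d 0 i) <= opnorm (diag_mx d).
Proof.
apply: ub_le_sup.
  exists (\big[Num.max/0]_j normc (d 0 j)) => _ [v /= v1 <-].
  have r0 : 0 <= \big[Num.max/0]_j normc (d 0 j) by exact: bigmax_ge_id.
  apply: (le_trans (l2norm_diag_le _ _ _ v r0 _)); last by rewrite ler_piMr.
  by move=> j; apply: le_bigmax.
exists (delta_mx i ord0) => /=.
  by rewrite -[delta_mx _ _]scale1r l2norm_scale_delta normc1.
rewrite -(l2norm_scale_delta n i); congr l2norm; apply/matrixP => j k.
by rewrite mul_diag_mx !mxE; case: eqVneq => [->|]; rewrite ?mulr0.
Qed.

Lemma opnorm_diag_lt n (d : 'rV[C]_n) (r : R) : 0 < r ->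
  opnorm (diag_mx d) < r <-> forall i, normc (d 0 i) < r.
Proof.
move=> r0; split=> [dr i|dr]; first exact: le_lt_trans (normc_le_opnorm n d i) dr.
apply: (@le_lt_trans _ _ (\big[Num.max/0]_j normc (d 0 j))).
  by apply: opnorm_diag_le => [|i]; [exact: bigmax_ge_id | exact: le_bigmax].
by apply: bigmax_lt.
Qed.

(** The bound [delta] makes [inf S] positive, so [1 / inf S <= 1] reads [1 <= inf S]; with
    [inf S = 0] the quotient would be the default 0. *)
Lemma mu_le1P n (E : set 'M[C]_n) (A : 'M[C]_n) (delta : R) : 0 < delta ->
  (forall X, E X -> \det (1%:M - A *m X) = 0 -> delta <= opnorm X) ->
  mu E A <= 1 <->
  forall X, E X -> opnorm X < 1 -> \det (1%:M - A *m X) != 0.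
Proof.
move=> delta0 lbE; rewrite /mu.
set S := [set opnorm X | X in _].
case: asboolP => [unitE|singE].
  split=> // _ X EX _; rewrite -unitfE; exact: unitE.
have S0 : S !=set0.
  move/existsNP: singE => [X /not_implyP[EX /negP]].
  by rewrite unitmxE unitfE negbK => /eqP dX; exists (opnorm X), X.
have inf_gt0 : 0 < inf S.
  apply: lt_le_trans delta0 _; apply: lb_le_inf => // _ [X [EX dX] <-].
  exact: lbE.
rewrite ler_pdivrMr// mul1r; split=> [inf1 X EX X1|nz].
  apply/eqP => dX; move: X1; rewrite ltNge => /negP; apply.
  apply: le_trans inf1 _; apply: ge_inf; last by exists X.
  by exists delta => _ [Y [EY dY] <-]; exact: lbE.
apply: lb_le_inf => // _ [X [EX dX] <-]; rewrite leNgt; apply/negP => X1.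
by move: (nz X EX X1); rewrite dX eqxx.
Qed.

End Norms.

(** * The two domains as sets of zero-free polynomials *)

Section Polynomials.
Variable R : realType.
Local Notation C := R[i].
Local Notation normc := (@normc R).

Definition poly7 (x : C7 R) (z1 z2 z3 : C) : C :=
  let: (x1, x2, x3, x4, x5, x6, x7) := x in
  1 - x1 * z1 - x2 * z2 + x3 * (z1 * z2) - x4 * z3 + x5 * (z1 * z3)
  + x6 * (z2 * z3) - x7 * (z1 * z2 * z3).

Definition poly5 (x : C5 R) (z1 z2 : C) : C :=
  let: (x1, x2, x3, y1, y2) := x in
  1 - x1 * z1 + x2 * (z1 * z2) - x3 * (z1 * z2 ^+ 2) - y1 * z2 + y2 * z2 ^+ 2.

Lemma det_mx33 (S : comPzRingType) (A : 'M[S]_3) :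
  \det A = A 0 0 * (A 1 1 * A 2 2 - A 1 2 * A 2 1)
         - A 0 1 * (A 1 0 * A 2 2 - A 1 2 * A 2 0)
         + A 0 2 * (A 1 0 * A 2 1 - A 1 1 * A 2 0).
Proof.
rewrite (expand_det_row _ 0) !big_ord_recl big_ord0 /cofactor.
rewrite !(expand_det_row _ 0) !big_ord_recl !big_ord0 /cofactor !det_mx11 !mxE /=.
(* Indexing by natural numbers lets the differently built ordinals of the expansion compute to the
   same entries for [ring]. *)
have [f fE] : exists f : nat -> nat -> S, forall i j, A i j = f i j.
  by exists (fun i j => A (inord i) (inord j)) => i j; rewrite !inord_val.
by rewrite !fE /=; ring.
Qed.

Definition mx33 (a11 a12 a13 a21 a22 a23 a31 a32 a33 : C) : 'M[C]_3 :=
  \matrix_(i < 3, j < 3)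
    (nth [::] [:: [:: a11; a12; a13]; [:: a21; a22; a23]; [:: a31; a32; a33]] i)`_j.

Lemma det_poly7 (A : 'M[C]_3) (z1 z2 z3 : C) :
  \det (1%:M - A *m diag3 z1 z2 z3) = poly7 (pi7 A) z1 z2 z3.
Proof.
by rewrite det_mx33 mul_mx_diag /poly7 /pi7 det_mx33 /minor2 !mxE /=; ring.
Qed.

Lemma exists_sum_prod (s p : C) : exists a b, a + b = s /\ a * b = p.
Proof.
pose d := sqrtc (s ^+ 2 - 4 * p).
have d2 : d ^+ 2 = s ^+ 2 - 4 * p by exact: sqr_sqrtc.
exists ((s + d) / 2), ((s - d) / 2); split; first by field.
have -> : (s + d) / 2 * ((s - d) / 2) = (s ^+ 2 - d ^+ 2) / 4 by field.
by rewrite d2; field.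
Qed.

(* The off-diagonal entries are only constrained through the products
   [a12 a21], [a13 a31], [a23 a32] and the two 3-cycles [a12 a23 a31],
   [a13 a32 a21]; the latter have prescribed sum and product. *)
Lemma exists_off_diagonal (p q r a b : C) : a * b = p * q * r ->
  exists a12 a13 a21 a23 a31 a32, [/\ a12 * a21 = p, a13 * a31 = q,
    a23 * a32 = r & a12 * a23 * a31 = a /\ a13 * a32 * a21 = b].
Proof.
move=> ab; have [a0|a0] := eqVneq a 0; last first.
  exists 1, (q / a), p, 1, a, r.
  split; [exact: mul1r | exact: mulfVK | exact: mul1r | split].
    by rewrite !mul1r.
  by apply: (mulfI a0); rewrite ab; field.
have [b0|b0] := eqVneq b 0; last first.
  exists (p / b), 1, b, r, q, 1.
  split; [exact: mulfVK | exact: mul1r | exact: mulr1 | split].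
    by apply: (mulIf b0); rewrite ab; field.
  by rewrite !mul1r.
(* Now one of [p], [q], [r] is zero; setting both entries of that pair to 0 kills both 3-cycles. *)
move: ab; rewrite a0 mul0r b0 => /esym/eqP.
rewrite !mulf_eq0 => /orP[/orP[]|] /eqP ->.
- by exists 0, 1, 0, 1, q, r; split; rewrite ?(mul0r, mulr0, mul1r).
- by exists 1, 0, p, 1, 0, r; split; rewrite ?(mul0r, mulr0, mul1r).
- by exists 1, 1, p, 0, q, 0; split; rewrite ?(mul0r, mulr0, mul1r).
Qed.

(** Diagonal and minors fix [p], [q], [r], hence the product of the two 3-cycles; the determinant
    then only prescribes their sum, and a quadratic equation yields both. *)
Lemma pi7_surj (x : C7 R) : exists A, pi7 A = x.
Proof.
case: x => [[[[[[x1 x2] x3] x4] x5] x6] x7].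
pose p := x1 * x2 - x3; pose q := x1 * x4 - x5; pose r := x2 * x4 - x6.
have [a [b [ab_sum ab_prod]]] := exists_sum_prod
  (x7 - x1 * x2 * x4 + x1 * r + x2 * q + x4 * p) (p * q * r).
have [a12 [a13 [a21 [a23 [a31 [a32 [pE qE rE [aE bE]]]]]]]] :=
  exists_off_diagonal _ _ _ _ _ ab_prod.
exists (mx33 x1 a12 a13 a21 x2 a23 a31 a32 x4).
rewrite /pi7 /minor2 det_mx33 !mxE /=.
congr (_, _, _, _, _, _, _); try by rewrite ?pE ?qE ?rE /p /q /r; ring.
transitivity (x1 * x2 * x4 - x1 * (a23 * a32) - x2 * (a13 * a31)
  - x4 * (a12 * a21) + (a12 * a23 * a31 + a13 * a32 * a21)); first by ring.
by rewrite pE qE rE aE bE ab_sum; ring.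
Qed.

(** The constant term is 1, while on the polydisc of radius [1 / (1 + M)] the other terms add up to
    at most [M / (1 + M) < 1]. This supplies the [delta] of [mu_le1P]. *)
Lemma poly7_neq0_near0 (x : C7 R) : exists2 delta : R, 0 < delta &
  forall z1 z2 z3, normc z1 < delta -> normc z2 < delta -> normc z3 < delta ->
  poly7 x z1 z2 z3 != 0.
Proof.
case: x => [[[[[[x1 x2] x3] x4] x5] x6] x7].
pose M := normc x1 + normc x2 + normc x3 + normc x4 + normc x5 + normc x6
  + normc x7.
have M0 : 0 <= M by rewrite /M !addr_ge0 ?normc_ge0.
have M1 : 0 < 1 + M by rewrite ltr_pwDl.
exists (1 + M)^-1; first by rewrite invr_gt0.
set e := (1 + M)^-1 => z1 z2 z3 z1e z2e z3e.
have e0 : 0 < e by rewrite invr_gt0.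
have e1 : e <= 1 by rewrite invf_le1// lerDl.
have mulD u v : normc u <= e -> normc v <= e -> normc (u * v) <= e.
  move=> ue ve; rewrite normcM -[e]mulr1.
  by rewrite ler_pM ?normc_ge0 // (le_trans ve).
have term (xi z : C) : normc z <= e -> normc (xi * z) <= normc xi * e.
  by move=> ze; rewrite normcM ler_wpM2l ?normc_ge0.
have {}z1e := ltW z1e; have {}z2e := ltW z2e; have {}z3e := ltW z3e.
have z12e := mulD _ _ z1e z2e; have z13e := mulD _ _ z1e z3e.
have z23e := mulD _ _ z2e z3e; have z123e := mulD _ _ z12e z3e.
apply/eqP => /= P0.
have E1 : 1 = x1 * z1 + x2 * z2 - x3 * (z1 * z2) + x4 * z3 - x5 * (z1 * z3)
    - x6 * (z2 * z3) + x7 * (z1 * z2 * z3).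
  by apply/eqP; rewrite -subr_eq0; apply/eqP; rewrite -[RHS]P0; ring.
have : 1 <= M * e.
  rewrite -(normc1 R) E1 /M !mulrDl.
  do 6!(apply: (le_trans (le_normcD _ _)); apply: lerD;
    last by rewrite ?normcN; apply: term).
  exact: term.
by rewrite leNgt => /negP; apply; rewrite ltr_pdivrMr // mul1r ltrDr.
Qed.

Lemma mu_diag3_le1P (E : set 'M[C]_3) (A : 'M[C]_3) :
  (forall X, E X -> exists z1 z2 z3, X = diag3 z1 z2 z3) ->
  mu E A <= 1 <->
  forall z1 z2 z3, E (diag3 z1 z2 z3) ->
    normc z1 < 1 -> normc z2 < 1 -> normc z3 < 1 ->
    poly7 (pi7 A) z1 z2 z3 != 0.
Proof.
move=> Ediag.
have opnorm_lt (r : R) z1 z2 z3 : 0 < r -> opnorm (diag3 z1 z2 z3) < r <->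
    [/\ normc z1 < r, normc z2 < r & normc z3 < r].
  move=> r0; rewrite opnorm_diag_lt //; split=> [zr|[z1r z2r z3r] i].
    by split; [have := zr 0 | have := zr 1 | have := zr 2]; rewrite mxE.
  by rewrite mxE; case: i => [[|[|[|//]]]].
have [delta delta0 nz] := poly7_neq0_near0 (pi7 A).
apply: (iff_trans (mu_le1P _ _ _ _ _ delta0 _)) => [X /Ediag[z1 [z2 [z3 ->]]]|].
  rewrite det_poly7 => P0; rewrite leNgt; apply/negP => /opnorm_lt[] // z1r z2r z3r.
  by have := nz _ _ _ z1r z2r z3r; rewrite P0 eqxx.
split=> [nzE z1 z2 z3 EX z1r z2r z3r|nzE X EX].
  by rewrite -det_poly7; apply: nzE => //; apply/opnorm_lt.
have [z1 [z2 [z3 XE]]] := Ediag X EX.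
by move: EX; rewrite XE => EX /opnorm_lt[] // *; rewrite det_poly7 nzE.
Qed.

Lemma Gamma111P (x : C7 R) : Gamma111 x <->
  forall z1 z2 z3, normc z1 < 1 -> normc z2 < 1 -> normc z3 < 1 ->
  poly7 x z1 z2 z3 != 0.
Proof.
have muP A : mu (@E111 R) A <= 1 <-> forall z1 z2 z3,
    normc z1 < 1 -> normc z2 < 1 -> normc z3 < 1 ->
    poly7 (pi7 A) z1 z2 z3 != 0.
  apply: (iff_trans (mu_diag3_le1P _ _ _)) => [X /is_diag_mxP Xdiag|]; last first.
    by split=> nz z1 z2 z3 *; apply: nz => //; exact: diag_mx_is_diag.
  exists (X 0 0), (X 1 1), (X 2 2); apply/matrixP => i j; rewrite !mxE.
  have [->|ij] := eqVneq i j; last by rewrite Xdiag.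
  rewrite mulr1n; case: j => [[|[|[|//]]]] ltj /=; congr (X _ _); exact: val_inj.
split=> [[A muA <-]|]; first exact/muP.
have [A <-] := pi7_surj x; move=> nz.
by exists A => //; apply/muP.
Qed.

(** Identifying the last two variables acts on coefficients in this way; [pi5 A] is convertible to
    [merge23 (pi7 A)]. *)
Definition merge23 (x : C7 R) : C5 R :=
  let: (x1, x2, x3, x4, x5, x6, x7) := x in (x1, x3 + x5, x7, x2 + x4, x6).

Lemma poly5_merge23 (x : C7 R) z1 z2 :
  poly5 (merge23 x) z1 z2 = poly7 x z1 z2 z2.
Proof.
by case: x => [[[[[[x1 x2] x3] x4] x5] x6] x7]; rewrite /poly5 /poly7 /=; ring.
Qed.

Lemma Gamma12P (x : C5 R) : Gamma12 x <->
  forall z1 z2, normc z1 < 1 -> normc z2 < 1 -> poly5 x z1 z2 != 0.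
Proof.
have muP A : mu (@E12 R) A <= 1 <-> forall z1 z2,
    normc z1 < 1 -> normc z2 < 1 -> poly5 (pi5 A) z1 z2 != 0.
  apply: (iff_trans (mu_diag3_le1P _ _ _)) => [_ [z1 [z2 ->]]|].
    by exists z1, z2, z2.
  rewrite -[pi5 A]/(merge23 (pi7 A)).
  split=> nz z1 z2 => [z1r z2r|z3 [w1 [w2 E]] z1r z2r z3r].
    by rewrite poly5_merge23 nz //; exists z1, z2.
  have zE (i : 'I_3) : [:: z1; z2; z3]`_i = [:: w1; w2; w2]`_i.
    by move/matrixP/(_ i i): E; rewrite !mxE eqxx !mulr1n.
  have z2w : z2 = w2 := zE 1; have z3w : z3 = w2 := zE 2.
  by rewrite z3w -z2w -poly5_merge23 nz.
split=> [[A muA <-]|]; first exact/muP.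
case: x => [[[[x1 x2] x3] y1] y2].
(* Any preimage under [merge23] would do; this one puts 0 in the fourth and fifth places. *)
have [A piA] := pi7_surj (x1, y1, x2, 0, 0, y2, x3).
have -> : (x1, x2, x3, y1, y2) = pi5 A.
  by rewrite -[pi5 A]/(merge23 (pi7 A)) piA /= !addr0.
by move=> nz; exists A => //; apply/muP.
Qed.

(** * Moving a zero of a bilinear polynomial to equal moduli *)

Lemma normc_sqr (z : C) : normc z ^+ 2 = complex.Re z ^+ 2 + complex.Im z ^+ 2.
Proof. by case: z => u v /=; rewrite sqr_sqrtr // addr_ge0 ?sqr_ge0. Qed.

(** Squared moduli are real polynomials in [t], which makes the intermediate value theorem for
    polynomials applicable. *)
Lemma normc_lin_poly (u v : C) :
  exists p : {poly R}, forall t : R, p.[t] = normc (u - t%:C * v) ^+ 2.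
Proof.
case: u v => [u1 u2] [v1 v2].
exists ((u1%:P - v1 *: 'X) ^+ 2 + (u2%:P - v2 *: 'X) ^+ 2) => t.
by rewrite normc_sqr !hornerE /=; ring.
Qed.

(* Along the segment from [w = 0] to a zero [(z0, w0)] with [|z0| <= |w0|],
   the sign of [|a - c w| - |w| |b - d w|] changes, so the root
   [z = (a - c w) / (b - d w)] meets the circle [|z| = |w|]. *)
Lemma bilinear_zero_torus_half (a b c d z0 w0 : C) :
  normc z0 <= normc w0 -> a - b * z0 - c * w0 + d * (z0 * w0) = 0 ->
  exists z w, [/\ normc z = normc w, normc w <= normc w0 &
    a - b * z - c * w + d * (z * w) = 0].
Proof.
move=> z0w0 Q0.
have [p pE] := normc_lin_poly a (c * w0).
have [q qE] := normc_lin_poly b (d * w0).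
pose f := normc w0 ^+ 2 *: ('X ^+ 2 * q) - p.
have fE (t : R) : f.[t] = (t * normc w0) ^+ 2 * normc (b - t%:C * (d * w0)) ^+ 2
    - normc (a - t%:C * (c * w0)) ^+ 2.
  by rewrite -pE -qE hornerD hornerN hornerZ hornerM hornerXn; ring.
have f01 : f.[0] <= 0 <= f.[1].
  rewrite !fE mul0r expr0n mul0r sub0r oppr_le0 sqr_ge0 /= !mul1r.
  (* At [t = 1] the zero itself gives this factorization, and [|z0| <= |w0|] gives the sign. *)
  have -> : a - c * w0 = z0 * (b - d * w0).
    by apply/eqP; rewrite -subr_eq0; apply/eqP; rewrite -[RHS]Q0; ring.
  rewrite normcM exprMn subr_ge0 ler_wpM2r ?sqr_ge0 //.
  by rewrite lerXn2r ?nnegrE ?normc_ge0.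
have [t /andP[t0 t1]] := poly_ivt ler01 f01.
rewrite /root fE subr_eq0 => /eqP ft.
pose w := t%:C * w0.
have normw : normc w = t * normc w0.
  rewrite normcM; congr (_ * _).
  by rewrite /ComplexField.Normc.normc /= expr0n addr0 sqrtr_sqr ger0_norm.
have lew : normc w <= normc w0 by rewrite normw ler_piMl ?normc_ge0.
have {ft} normaw : normc (a - c * w) = normc w * normc (b - d * w).
  apply/eqP; rewrite -(@eqrXn2 _ 2) ?mulr_ge0 ?normc_ge0 //; apply/eqP.
  rewrite exprMn normw.
  have -> : a - c * w = a - t%:C * (c * w0) by rewrite /w; ring.
  have -> : b - d * w = b - t%:C * (d * w0) by rewrite /w; ring.
  by rewrite -ft.
(* If the denominator vanishes, so does [a - c w]: every [z] is then a root, in particular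
   [z = w]. *)
have [bw0|bw0] := eqVneq (b - d * w) 0.
  exists w, w; split=> //.
  have aw0 : a - c * w = 0 by apply: eq0_normc; rewrite normaw bw0 normc0 mulr0.
  by rewrite -[RHS](subr0 0) -{1}aw0 -(mul0r w) -bw0; ring.
exists ((a - c * w) / (b - d * w)), w; split=> //; last by field.
rewrite normcM normcV normaw mulfK //.
by apply: contra bw0 => /eqP/eq0_normc ->.
Qed.

(** The case [|w0| < |z0|] follows by exchanging the variables together with [b] and [c]. *)
Lemma bilinear_zero_torus (a b c d z0 w0 : C) :
  normc z0 < 1 -> normc w0 < 1 -> a - b * z0 - c * w0 + d * (z0 * w0) = 0 ->
  exists z w, [/\ normc z = normc w, normc w < 1 &
    a - b * z - c * w + d * (z * w) = 0].
Proof.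
move=> z1 w1 Q0; have [zw|/ltW wz] := lerP (normc z0) (normc w0).
  have [z [w [zw' ww0 Q]]] := bilinear_zero_torus_half _ _ _ _ _ _ zw Q0.
  by exists z, w; split=> //; exact: le_lt_trans w1.
have [|w [z [wz' zz0 Q]]] := bilinear_zero_torus_half a c b d _ _ wz.
  by rewrite -[RHS]Q0; ring.
exists z, w; split=> //; first by rewrite wz' (le_lt_trans zz0).
by rewrite -[RHS]Q; ring.
Qed.

Lemma poly7_neq0_torus (x : C7 R) :
  (forall z1 z2 eta, normc z1 < 1 -> normc z2 < 1 -> normc eta = 1 ->
    poly7 x z1 z2 (eta * z2) != 0) ->
  forall z1 z2 z3, normc z1 < 1 -> normc z2 < 1 -> normc z3 < 1 ->
    poly7 x z1 z2 z3 != 0.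
Proof.
case: x => [[[[[[x1 x2] x3] x4] x5] x6] x7] nz z1 z2 z3 z1r z2r z3r.
apply/eqP => P0.
have [|||z [w [zw w1 Q]]] := bilinear_zero_torus (1 - x1 * z1)
    (x2 - x3 * z1) (x4 - x5 * z1) (x6 - x7 * z1) z2 z3 => //.
  by rewrite -[RHS]P0 /=; ring.
(* Equal moduli make [w / z] unimodular; if [z = 0] then [w = 0] and 1 serves. *)
have [eta eta1 wE] : exists2 eta, normc eta = 1 & w = eta * z.
  have [z0|z0] := eqVneq z 0.
    exists 1; first exact: normc1.
    by rewrite mul1r z0; apply: eq0_normc; rewrite -zw z0 normc0.
  exists (w / z); last by rewrite divfK.
  rewrite normcM normcV -zw mulfV //.
  by apply: contra z0 => /eqP/eq0_normc ->.
have := nz z1 z eta z1r; rewrite zw => /(_ w1 eta1)/eqP; apply.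
by rewrite -wE -[RHS]Q /=; ring.
Qed.

End Polynomials.

Theorem theorem3p20 (R : realType) (x1 x2 x3 x4 x5 x6 x7 : R[i]) :
  @K R (x1, x2, x3, x4, x5, x6, x7) <->
  (forall eta : R[i], `|eta| = 1 :> R[i] ->
     @K1 R (x1, x3 + eta * x5, eta * x7, x2 + eta * x4, eta * x6)).
Proof.
have poly_eta eta z1 z2 :
    poly5 R (x1, x3 + eta * x5, eta * x7, x2 + eta * x4, eta * x6) z1 z2 =
    poly7 R (x1, x2, x3, x4, x5, x6, x7) z1 z2 (eta * z2).
  by rewrite /=; ring.
split=> [[/Gamma111P nz [x1E x3E x5E x7E]] eta eta1|KE].
  (* Inserting this factor 1 matches the conjugate of [eta] coming from the [y] coordinates with the
     factor [eta] of [eta * x7]. *)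
  have etaK : eta^* * eta = 1 by rewrite mulrC -sqr_normc eta1 expr1n.
  split; first (apply/Gamma12P => z1 z2 z1r z2r; rewrite poly_eta nz //).
    by move/norm_eq1: eta1 => eta1; rewrite normcM eta1 mul1r.
  split; last by rewrite normrM eta1 x7E mulr1.
  - by rewrite rmorphM x1E -[LHS]mul1r -etaK /=; ring.
  - by rewrite rmorphD rmorphM x3E x5E -[X in X + _]mul1r -etaK /=; ring.
split.
  apply/Gamma111P/poly7_neq0_torus => z1 z2 eta z1r z2r eta1.
  have [|/Gamma12P nz _] := KE eta; first exact/norm_eq1.
  by rewrite -poly_eta nz.
have [|_ []] := KE 1; first by rewrite normr1.
rewrite !mul1r => x1E plusE x7E.
have [|_ []] := KE (-1); first by rewrite normrN1.
rewrite !mulN1r rmorphB /= => _ minusE _.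
move: plusE; rewrite rmorphD /= => plusE.
(* Half the sum of the relations at 1 and -1 isolates [x3], half their difference [x5]. *)
split=> //.
- apply: (@mulfI _ 2); first by rewrite pnatr_eq0.
  transitivity ((x3 + x5) + (x3 - x5)); first by ring.
  by rewrite plusE minusE; ring.
- apply: (@mulfI _ 2); first by rewrite pnatr_eq0.
  transitivity ((x3 + x5) - (x3 - x5)); first by ring.
  by rewrite plusE minusE; ring.
Qed.
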